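(* Let $G$ be a finite group and let $\mathsf{S}$ be a supercharacter theory of $G$. A subgroup $H\le G$ is $\mathsf{S}$-normal if and only if $[H,\mathsf{S}]\le H$.
   Context: Let $G$ be a finite group and $\mathrm{Irr}(G)$ its set of complex irreducible characters. A supercharacter theory $\mathsf{S}$ of $G$ is a pair $(\mathcal{X}_{\mathsf{S}},\mathcal{K}_{\mathsf{S}})$, where $\mathcal{X}_{\mathsf{S}}$ is a partition of $\mathrm{Irr}(G)$ and $\mathcal{K}_{\mathsf{S}}$ is a partition of $G$, such that $\{1\}\in\mathcal{K}_{\mathsf{S}}$, $|\mathcal{X}_{\mathsf{S}}|=|\mathcal{K}_{\mathsf{S}}|$, and for each $X\in\mathcal{X}_{\mathsf{S}}$ there is a (nonzero) character $\xi_X$ whose constituents lie in $X$ and which is constant on the parts of $\mathcal{K}_{\mathsf{S}}$. It is known that every part of $\mathcal{K}_{\mathsf{S}}$ is then a union of conjugacy classes. The parts of $\mathcal{K}_{\mathsf{S}}$ are called $\mathsf{S}$-classes, and $\mathrm{cl}_{\mathsf{S}}(g)$ is the $\mathsf{S}$-class containing $g$. A subgroup of $G$ is $\mathsf{S}$-normal if it is a union of $\mathsf{S}$-classes. For $H\le G$, $[H,\mathsf{S}]=\langle g^{-1}k:g\in H,\ k\in\mathrm{cl}_{\mathsf{S}}(g)\rangle$. *)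

(* Defs.v *)
From mathcomp Require Import all_boot all_order all_fingroup all_algebra.
From mathcomp Require Import all_solvable all_field all_character.

Set Implicit Arguments.
Unset Strict Implicit.
Unset Printing Implicit Defensive.

Import GroupScope.

(* Irr(G) is represented by its index type [Iirr G], via ['chi[G]_i]. *)
Record superchar_theory (gT : finGroupType) (G : {group gT}) :=
  SupercharTheory {
    superchar_parts : {set {set Iirr G}};
    superclasses : {set {set gT}};
    superchar_parts_partition : partition superchar_parts [set: Iirr G];
    superclasses_partition : partition superclasses G;
    superclasses1 : [set 1] \in superclasses;
    card_superchar_theory : #|superchar_parts| = #|superclasses|;
    superchar_exists :
      forall X, X \in superchar_parts ->
      exists xi : 'CF(G),
        [/\ xi \is a character, xi != 0%R,
            {subset irr_constt xi <= X}
          & forall K, K \in superclasses -> {in K &, forall g h, xi g = xi h}]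
  }.

(* [pblock] returns [set0] at points outside [G]. *)
Definition superclass_of (gT : finGroupType) (G : {group gT})
    (S : superchar_theory G) (g : gT) : {set gT} :=
  pblock (superclasses S) g.

Definition S_normal (gT : finGroupType) (G : {group gT})
    (S : superchar_theory G) (H : {group gT}) : Prop :=
  exists2 P : {set {set gT}},
    P \subset superclasses S & H = \bigcup_(K in P) K :> {set gT}.

Definition S_commutator (gT : finGroupType) (G : {group gT})
    (S : superchar_theory G) (H : {group gT}) : {set gT} :=
  <<[set g^-1 * k | g in H, k in superclass_of S g]>>.

(* Main.v *)
Require Import Defs.
From mathcomp Require Import all_boot all_order all_fingroup all_algebra.
From mathcomp Require Import all_solvable all_field all_character.

(** Both conditions say that [H] contains the whole superclass of each of its
    elements. For the commutator condition this holds because [H] is closed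
    under multiplication: if [g] is in [H], then the generator [g^-1 * k] lies
    in [H] exactly when [k] does ([S_commutator_subP]). For S-normality it
    holds because the superclasses partition [G]: a superclass meeting a union
    of superclasses is one of those in the union, and conversely a subset of
    [G] containing the superclasses of its elements is their union
    ([S_normalP]). *)

Import GroupScope.

Lemma S_commutator_subP (gT : finGroupType) (G : {group gT})
    (S : superchar_theory G) (H : {group gT}) :
  reflect {in H, forall g, superclass_of S g \subset H}
          (S_commutator S H \subset H).
Proof.
rewrite gen_subG; apply: (iffP subsetP) => [sRH g Hg | sKH _ /imset2P[g k Hg Kk ->]].
  apply/subsetP=> k Kk; rewrite -(groupMl k (groupVr Hg)).
  by apply: sRH; apply: imset2_f.
rewrite groupM ?groupV //.
exact: (subsetP (sKH g Hg)).
Qed.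

Lemma S_normalP (gT : finGroupType) (G : {group gT})
    (S : superchar_theory G) (H : {group gT}) (sHG : H \subset G) :
  S_normal S H <-> {in H, forall g, superclass_of S g \subset H}.
Proof.
have /and3P[/eqP covG trivK _] := superclasses_partition S.
(* A point of [H] outside [G] would have an empty superclass and be lost in
   the union of superclasses built below. *)
have coverH g : g \in H -> g \in cover (superclasses S).
  by rewrite covG; apply: (subsetP sHG).
split=> [[P sPK defH] g | sKH].
  rewrite defH => /bigcupP[K PK Kg].
  rewrite /superclass_of (def_pblock trivK (subsetP sPK K PK) Kg).
  exact: bigcup_sup PK.
exists [set superclass_of S g | g in H].
  by apply/subsetP=> _ /imsetP[g Hg ->]; apply: pblock_mem (coverH g Hg).
apply/eqP; rewrite eqEsubset; apply/andP; split.
  apply/subsetP=> g Hg; apply/bigcupP; exists (superclass_of S g).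
    exact: imset_f.
  by rewrite mem_pblock coverH.
by apply/bigcupsP=> _ /imsetP[g Hg ->]; apply: sKH.
Qed.

Theorem corollary12 (gT : finGroupType) (G : {group gT})
    (S : superchar_theory G) (H : {group gT}) (sHG : H \subset G) :
  S_normal S H <-> S_commutator S H \subset H.
Proof.
exact: iff_trans (S_normalP _ _ S H sHG) (rwP (S_commutator_subP _ _ S H)).
Qed.
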